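(* Let $t,m$ be positive integers, let $r_1,\dots,r_m\in\{-1,1\}^t$, let $u>\ell>0$ be real numbers, let $\lambda\in\mathbb{N}$ with $\lambda\le m$, and let $\bar\eta=\max\{\lambda,m-\lambda\}$. Then $M=ut+1$ is a valid big-$M$ for Problem (P1).
   Context: Notation: $[1,k]=\{1,\dots,k\}$ for a positive integer $k$. Here $t$ is the number of decision trees, $m$ the number of unlabeled points, $r_i=(r_i^1,\dots,r_i^t)\in\{-1,1\}^t$ is the vector of classifications of the $i$-th unlabeled point by the $t$ trees, and $\lambda$ is the known total number of the $m$ unlabeled points that belong to the positive class. Problem (P1) is the mixed-integer linear problem in the variables $\alpha\in\mathbb{R}^t$, $\eta\in\mathbb{R}$, $z\in\{0,1\}^m$: $$\min_{\alpha,\eta,z}\ \eta$$ subject to $$\alpha^\top r_i\le -1+z_iM,\quad i\in[1,m],$$ $$\alpha^\top r_i\ge 1-(1-z_i)M,\quad i\in[1,m],$$ $$\lambda-\eta\le\sum_{i=1}^m z_i\le\lambda+\eta,$$ $$\ell\le\alpha_j\le u,\quad j\in[1,t],$$ $$0\le\eta\le\bar\eta,$$ $$z_i\in\{0,1\},\quad i\in[1,m].$$ The two big-$M$ constraints model the requirement that, for every $i\in[1,m]$, $\alpha^\top r_i\le -1$ if $z_i=0$ and $\alpha^\top r_i\ge 1$ if $z_i=1$. A constant $M$ is called a valid big-$M$ for (P1) if it does not cut off any feasible solution, i.e., every $(\alpha,\eta,z)$ that satisfies, for every $i\in[1,m]$, the requirement ''$\alpha^\top r_i\le -1$ if $z_i=0$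 and $\alpha^\top r_i\ge 1$ if $z_i=1$'' together with the remaining constraints ($\lambda-\eta\le\sum_{i=1}^m z_i\le\lambda+\eta$, $\ell\le\alpha_j\le u$ for all $j\in[1,t]$, $0\le\eta\le\bar\eta$, $z\in\{0,1\}^m$) is feasible for (P1) with this $M$. *)

(* Defs.v *)
From HB Require Import structures.
From mathcomp Require Import all_boot all_order all_algebra.
From mathcomp Require Import reals.

Set Implicit Arguments.
Unset Strict Implicit.
Unset Printing Implicit Defensive.

Import Order.TTheory GRing.Theory Num.Theory.

Local Open Scope ring_scope.

Definition dotc (R : realType) (t : nat) (a b : 'cV[R]_t) : R :=
  (a^T *m b) 0 0.

(* A point of the problem is a triple (alpha, eta, z). The variable z ranges
   over real vectors and its binarity is one of the constraints. The objective
   eta is not recorded, since validity of a big-M only concerns feasibility. *)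

Definition common_constraints (R : realType) (t m : nat)
    (lambda : nat) (ell u eta_bar : R)
    (alpha : 'cV[R]_t) (eta : R) (z : 'cV[R]_m) : Prop :=
  [/\ lambda%:R - eta <= \sum_(i < m) z i 0 <= lambda%:R + eta,
      forall j : 'I_t, ell <= alpha j 0 <= u,
      0 <= eta <= eta_bar
    & forall i : 'I_m, z i 0 = 0 \/ z i 0 = 1].

Definition bigM_constraints (R : realType) (t m : nat)
    (r : 'I_m -> 'cV[R]_t) (M : R)
    (alpha : 'cV[R]_t) (z : 'cV[R]_m) : Prop :=
  (forall i : 'I_m, dotc alpha (r i) <= - 1 + z i 0 * M) /\
  (forall i : 'I_m, dotc alpha (r i) >= 1 - (1 - z i 0) * M).

Definition logical_constraints (R : realType) (t m : nat)
    (r : 'I_m -> 'cV[R]_t) (alpha : 'cV[R]_t) (z : 'cV[R]_m) : Prop :=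
  forall i : 'I_m,
    (z i 0 = 0 -> dotc alpha (r i) <= - 1) /\
    (z i 0 = 1 -> dotc alpha (r i) >= 1).

Definition P1_feasible (R : realType) (t m : nat) (r : 'I_m -> 'cV[R]_t)
    (lambda : nat) (ell u eta_bar M : R)
    (alpha : 'cV[R]_t) (eta : R) (z : 'cV[R]_m) : Prop :=
  bigM_constraints r M alpha z /\
  common_constraints lambda ell u eta_bar alpha eta z.

Definition valid_bigM (R : realType) (t m : nat) (r : 'I_m -> 'cV[R]_t)
    (lambda : nat) (ell u eta_bar M : R) : Prop :=
  forall (alpha : 'cV[R]_t) (eta : R) (z : 'cV[R]_m),
    logical_constraints r alpha z ->
    common_constraints lambda ell u eta_bar alpha eta z ->
    P1_feasible r lambda ell u eta_bar M alpha eta z.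

(* Main.v *)
Require Import Defs.
From HB Require Import structures.
From mathcomp Require Import all_boot all_order all_algebra.
From mathcomp Require Import reals lra.

(** The bound [- u t <= alpha^T r_i <= u t] holds on the whole box of the
    [alpha], because the entries of [r_i] are signs and [0 < alpha_j <= u]; this
    is [normr_dotc_le]. For a binary [z_i], one of the two big-[M] inequalities
    is the logical requirement itself, and the other one reads
    [alpha^T r_i >= 1 - M] if [z_i = 0] and [alpha^T r_i <= M - 1] if [z_i = 1].
    With [M = u t + 1] the latter are exactly the two halves of that bound. *)

Set Implicit Arguments.
Unset Strict Implicit.
Unset Printing Implicit Defensive.

Import Order.TTheory GRing.Theory Num.Theory.

Local Open Scope ring_scope.

(** This is Hoelder's inequality for the sup norm of [a] and the l1 norm of [b]:
    the l1 norm of a vector with entries in the unit ball is at most its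
    dimension. *)
Lemma normr_dotc_le (R : realType) (t : nat) (a b : 'cV[R]_t) (u : R) :
  (forall j, `|a j 0| <= u) -> (forall j, `|b j 0| <= 1) ->
  `|dotc a b| <= u * t%:R.
Proof.
move=> a_le b_le; rewrite /dotc mxE; apply: (le_trans (ler_norm_sum _ _ _)).
have -> : u * t%:R = \sum_(j < t) u.
  by rewrite sumr_const card_ord mulr_natr.
apply: ler_sum => j _; rewrite mxE normrM -[leRHS]mulr1.
exact: ler_pM.
Qed.

Theorem proposition1 (R : realType) (t m : nat) (ht : (0 < t)%N) (hm : (0 < m)%N)
    (r : 'I_m -> 'cV[R]_t)
    (hr : forall (i : 'I_m) (j : 'I_t), r i j 0 = - 1 \/ r i j 0 = 1)
    (ell u : R) (hell : 0 < ell) (hu : ell < u)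
    (lambda : nat) (hlambda : (lambda <= m)%N) :
  valid_bigM r lambda ell u (Num.max (lambda%:R) (m%:R - lambda%:R))
    (u * t%:R + 1).
Proof.
move=> alpha eta z logic common; split=> //.
case: common => _ alpha_box _ z_bin.
have dot_le i : - (u * t%:R) <= dotc alpha (r i) <= u * t%:R.
  rewrite -ler_norml; apply: normr_dotc_le => j.
    have /andP[ell_le le_u] := alpha_box j.
    by rewrite ger0_norm // (le_trans (ltW hell)).
  by case: (hr i j) => ->; rewrite ?normrN normr1.
split=> i; have /andP[ge_ut le_ut] := dot_le i; have [neg pos] := logic i.
  by case: (z_bin i) => zi; rewrite zi; [have := neg zi | ]; lra.
by case: (z_bin i) => zi; rewrite zi; [ | have := pos zi]; lra.
Qed.
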